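(* Let $(X,d)$ be a metric space, and let $U(X)$ be the set of real-valued uniformly continuous functions on $X$. Then $U(X)$ is a ring (under pointwise addition and multiplication) if and only if every subset $A\subset X$ that is not a Bourbaki-bounded subset of $X$ contains an infinite uniformly isolated subset.
   Context: Let $(X,d)$ be a metric space. $U(X)$ denotes the set of all uniformly continuous functions $f:X\to\mathbb{R}$; saying that $U(X)$ is a ring refers to the pointwise operations, i.e. it means that the pointwise product of any two functions in $U(X)$ is again in $U(X)$. A subset $A\subset X$ is a Bourbaki-bounded subset of $X$ if for every $f\in U(X)$ the restriction $f|_A:A\to\mathbb{R}$ is bounded. For $x\in X$, the isolation index is $I(x)=d(x,X\setminus\{x\})=\inf\{d(x,y): y\in X,\ y\neq x\}$. A subset $F\subset X$ is uniformly isolated (in $X$) if $\inf\{I(a): a\in F\}>0$, with the convention $\inf\emptyset=+\infty$. Equivalently, there is $\varepsilon>0$ such that $d(a,x)\geq\varepsilon$ for every $a\in F$ and every $x\in X$ with $x\neq a$. *)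

(* Defs.v *)
From mathcomp Require Import all_boot all_order all_algebra.
From mathcomp Require Import all_classical all_reals all_analysis.

Set Implicit Arguments.
Unset Strict Implicit.
Unset Printing Implicit Defensive.

Import Order.TTheory GRing.Theory Num.Theory.
Import numFieldNormedType.Exports.

Local Open Scope classical_set_scope.
Local Open Scope ring_scope.

Definition UC (R : realType) (X : metricType R) : set (X -> R) :=
  [set f | unif_continuous f].
Arguments UC {R} X.

(* [X -> R] carries the pointwise ring structure of the library. Closure under
   subtraction and the constant function 1 hold for every [X], so the condition
   is about products only: see [UC_is_ringP]. *)
Definition UC_is_ring (R : realType) (X : metricType R) : Prop :=
  subring_closed [in UC X].
Arguments UC_is_ring {R} X.

Definition bourbaki_bounded (R : realType) (X : metricType R) (A : set X) :
    Prop :=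
  forall f, UC X f -> [bounded f x | x in A].

(* Since [ereal_inf set0 = +oo], the index is [+oo] if [x] is the only point. *)
Definition isolation_index (R : realType) (X : metricType R) (x : X) : \bar R :=
  ereal_inf [set (mdist x y)%:E | y in [set y | y != x]].

Definition uniformly_isolated (R : realType) (X : metricType R) (F : set X) :
    Prop :=
  (0 < ereal_inf [set isolation_index a | a in F])%E.

Lemma UC_P (R : realType) (X : metricType R) (f : X -> R) :
  UC X f <-> forall e : R, 0 < e -> exists2 d : R, 0 < d &
    forall x y, mdist x y < d -> `|f x - f y| < e.
Proof.
rewrite /UC /=; split=> [/unif_continuousP fu e e0 | fu].
  have [d d0 fd] := fu _ e0; exists d => // x y xyd.
  by have := fd (x, y); rewrite ballEmdist; apply.
apply/unif_continuousP => e /fu[d d0 fd]; exists d => // -[x y] /=.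
by rewrite ballEmdist /=; exact: fd.
Qed.

Lemma UC_is_ringP (R : realType) (X : metricType R) :
  UC_is_ring X <->
  forall f g : X -> R, UC X f -> UC X g -> UC X (fun x => f x * g x).
Proof.
split=> [[_ _ UM] f g Uf Ug | UM].
  by have /set_mem := UM f g (mem_set Uf) (mem_set Ug).
split=> [|f g /set_mem/UC_P Uf /set_mem/UC_P Ug|f g /set_mem Uf /set_mem Ug];
  apply/mem_set; last exact: UM.
- by apply/UC_P => e e0; exists 1 => // x y _; rewrite subrr normr0.
apply/UC_P => e e0.
have e20 : 0 < e / 2 by rewrite divr_gt0.
have [d d0 fd] := Uf _ e20; have [d' d'0 gd] := Ug _ e20.
exists (Num.min d d') => [|x y]; first by rewrite lt_min d0.
rewrite lt_min => /andP[/fd fxy /gd gxy].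
have -> : (f - g) x - (f - g) y = (f x - f y) - (g x - g y).
  by rewrite !fctE opprD addrACA -opprD.
by rewrite (splitr e) (le_lt_trans (ler_normB _ _))// ltrD.
Qed.

Lemma uniformly_isolatedP (R : realType) (X : metricType R) (F : set X) :
  uniformly_isolated F <->
  exists2 e : R, 0 < e & forall a x, F a -> x != a -> e <= mdist a x.
Proof.
rewrite /uniformly_isolated; split=> [|[e e0 Fe]]; last first.
  apply: (@lt_le_trans _ _ e%:E); first by rewrite lte_fin.
  apply: le_ereal_inf_tmp => _ [a Fa <-].
  by apply: le_ereal_inf_tmp => _ [x xa <-]; rewrite lee_fin Fe.
set m := ereal_inf _ => m0.
have Fm a x : F a -> x != a -> (m <= (mdist a x)%:E)%E.
  move=> Fa xa; apply: (@le_trans _ _ (isolation_index a)).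
    by apply: ereal_inf_lbound; exists a.
  by apply: ereal_inf_lbound; exists x.
case: m m0 Fm => [r r0 Fr|_ Fm|//].
  by exists r => // a x Fa /(Fr _ _ Fa); rewrite lee_fin.
by exists 1 => // a x Fa /(Fm _ _ Fa).
Qed.

(* Main.v *)
Require Import Defs.
From mathcomp Require Import all_boot all_order all_algebra.
From mathcomp Require Import all_classical all_reals all_analysis.
From mathcomp Require Import ring lra.
Set Implicit Arguments.
Unset Strict Implicit.
Import Order.TTheory GRing.Theory Num.Theory.
Import numFieldNormedType.Exports.
Local Open Scope ring_scope.
Local Open Scope classical_set_scope.

(** If [f * g] is not uniformly continuous, this is witnessed by pairs
    [x n <> y n] at distance tending to [0]. The set of the [x n] is not
    Bourbaki-bounded, as the product of two uniformly continuous functions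
    behaves well near a set where both are bounded; but a uniformly isolated set
    contains only finitely many [x n].

    Conversely, let [f] be uniformly continuous and unbounded on a set [A] all
    of whose uniformly isolated subsets are finite. Each set
    [{a in A | t < |f a|}] is infinite, hence not uniformly isolated. This
    yields points [x n] with [|f (x n)|] growing by steps larger than [1], and
    [y n <> x n] with [d (x n) (y n)] tending to [0]. A supremum [h] of steep
    bumps of height [1 / |f (x n)|] around [x n] that vanish at [y n] is
    uniformly continuous because the heights tend to [0], but [|f| * h] jumps
    by at least [1] between [x n] and [y n]. *)

Lemma bounded_on_setP (R : realType) (T : Type) (A : set T) (f : T -> R) :
  [bounded f x | x in A] <-> exists M : R, forall x, A x -> `|f x| <= M.
Proof.
split=> [[M [_ fM]]|[M fM]].
  by exists (M + 1) => x Ax; apply: (fM (M + 1)) => //; rewrite ltrDl.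
by exists M; split=> [|N /ltW MN x /fM/le_trans]; [exact: num_real | exact].
Qed.

Lemma finite_set_bounded_on (R : realType) (T : Type) (A : set T) (f : T -> R) :
  finite_set A -> exists M : R, forall x, A x -> `|f x| <= M.
Proof.
move=> finA; have := compact_bounded (finite_compact (finite_image f finA)).
by move=> /bounded_on_setP[M fM]; exists M => x Ax; apply: fM; exists x.
Qed.

Lemma invnS_lt (R : realType) (e : R) :
  0 < e -> exists N, forall n, (N <= n)%N -> n.+1%:R^-1 < e.
Proof.
move=> e0; have [N _ HN] := near_infty_natSinv_lt (PosNum e0).
by exists N => n Nn; apply: HN.
Qed.

Section UniformContinuity.
Context {R : realType} {X : metricType R}.
Implicit Types f g : X -> R.

Lemma UC_norm f : UC X f -> UC X (fun x => `|f x|).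
Proof.
move=> /UC_P Uf; apply/UC_P => e /Uf[d d0 fd]; exists d => // x y /fd.
exact/le_lt_trans/ler_dist_dist.
Qed.

Lemma UC_lipschitz f (k : R) :
  (forall x y, `|f x - f y| <= k * mdist x y) -> UC X f.
Proof.
move=> fk; apply/UC_P => e e0; have k0 : 0 < `|k| + 1 by rewrite ltr_wpDl.
exists (e / (`|k| + 1)) => [|x y]; first exact: divr_gt0.
rewrite ltr_pdivlMr// mulrC; apply: le_lt_trans; rewrite (le_trans (fk x y))//.
by rewrite ler_wpM2r ?mdist_ge0// (le_trans (ler_norm k))// lerDl.
Qed.

Lemma UC_mul_bounded f g (A : set X) :
    UC X f -> UC X g -> [bounded f x | x in A] -> [bounded g x | x in A] ->
  forall e : R, 0 < e -> exists2 d : R, 0 < d &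
    forall x y, A x -> mdist x y < d -> `|f x * g x - f y * g y| < e.
Proof.
move=> /UC_P Uf /UC_P Ug /bounded_on_setP[M fM] /bounded_on_setP[N gN] e e0.
have C0 : 0 < `|M| + `|N| + 1 by rewrite ltr_wpDl// addr_ge0.
pose eta := Num.min 1 (e / (`|M| + `|N| + 1)).
have eta0 : 0 < eta by rewrite lt_min ltr01 divr_gt0.
have [d d0 fd] := Uf _ eta0; have [d' d'0 gd] := Ug _ eta0.
exists (Num.min d d') => [|x y Ax]; first by rewrite lt_min d0.
rewrite lt_min => /andP[/fd fxy /gd gxy].
have etaC : eta * (`|M| + `|N| + 1) <= e.
  by rewrite -ler_pdivlMr// /eta ge_min lexx orbT.
have eta1 : eta <= 1 by rewrite /eta ge_min lexx.
have fx : `|f x| <= `|M| by rewrite (le_trans (fM _ Ax))// ler_norm.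
have gy : `|g y| <= `|N| + 1.
  rewrite -[g y](subKr (g x)) (le_trans (ler_normB _ _))// lerD//.
    by rewrite (le_trans (gN _ Ax))// ler_norm.
  by rewrite (le_trans (ltW gxy)).
have -> : f x * g x - f y * g y = f x * (g x - g y) + (f x - f y) * g y by ring.
rewrite (le_lt_trans (ler_normD _ _))// !normrM; apply: lt_le_trans etaC.
rewrite [ltRHS](_ : _ = `|M| * eta + eta * (`|N| + 1)); last by ring.
apply: ler_ltD; first by rewrite ler_pM// ltW.
apply: (@le_lt_trans _ _ (`|f x - f y| * (`|N| + 1))).
  by rewrite ler_wpM2l.
by rewrite ltr_pM2r// ltr_wpDl.
Qed.

Lemma UC_sup (B : nat -> X -> R) (c : nat -> R) :
    (forall n, UC X (B n)) -> (forall n x, 0 <= B n x <= c n) ->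
    c @ \oo --> (0 : R) ->
  UC X (fun x => sup (range (B^~ x))).
Proof.
move=> UB Bc c0; apply/UC_P => e e0.
have [N _ cN] : \forall n \near \oo, `|0 - c n| < e / 2.
  by move/cvgrPdist_lt : c0; apply; rewrite divr_gt0.
have equi M : exists2 d : R, 0 < d & forall n x y, (n < M)%N ->
    mdist x y < d -> `|B n x - B n y| < e / 2.
  elim: M => [|M [d d0 Bd]]; first by exists 1.
  have /UC_P/(_ _ (divr_gt0 e0 (ltr0Sn _ 1)))[d' d'0 Bd'] := UB M.
  exists (Num.min d d') => [|n x y]; first by rewrite lt_min d0.
  rewrite ltnS lt_min leq_eqVlt => /orP[/eqP->|nM] /andP[xyd xyd'].
    exact: Bd'.
  exact: Bd.
have ubB x : has_ubound (range (B^~ x)).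
  have /cvg_seq_bounded/bounded_on_setP[M cM] : cvgn c.
    by apply/cvg_ex; exists 0.
  exists M => _ [n _ <-]; have /andP[_ /le_trans->//] := Bc n x.
  by rewrite (le_trans (ler_norm _))// cM.
have [d d0 Bd] := equi N; exists d => // x y xyd.
have half u v : mdist u v < d ->
    sup (range (B^~ u)) <= sup (range (B^~ v)) + e / 2.
  move=> uvd; apply: ge_sup; first by exists (B 0 u); exists 0.
  move=> _ [n _ <-]; have Bv : B n v <= sup (range (B^~ v)).
    by apply: ub_le_sup => //; exists n.
  have [nN|Nn] := ltnP n N.
    have := Bd n u v nN uvd; rewrite ltr_norml => /andP[_ Buv]; lra.
  have := cN n Nn; rewrite sub0r normrN ltr_norml => /andP[_ cne].
  have := Bc n u; have := Bc n v; lra.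
have := half x y xyd; have := half y x; rewrite metric_sym => /(_ xyd) yx xy.
by rewrite ltr_norml; apply/andP; split; lra.
Qed.

Definition bump (a : X) (r c : R) (x : X) : R :=
  c * Num.max 0 (1 - mdist a x / r).

Lemma bump_center a r c : bump a r c a = c.
Proof. by rewrite /bump mdistxx mul0r subr0 max_r// mulr1. Qed.

Lemma bump_out a r c x : 0 < r -> r <= mdist a x -> bump a r c x = 0.
Proof.
by move=> r0 rax; rewrite /bump max_l ?mulr0// subr_le0 ler_pdivlMr// mul1r.
Qed.

Lemma bump_ge0_le a r c x : 0 < r -> 0 <= c -> 0 <= bump a r c x <= c.
Proof.
move=> r0 c0; rewrite mulr_ge0 ?le_max ?lexx//= ler_piMr// ge_max ler01/=.
by rewrite gerBl divr_ge0 ?mdist_ge0// ltW.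
Qed.

Lemma UC_bump a r c : 0 < r -> 0 <= c -> UC X (bump a r c).
Proof.
move=> r0 c0; apply: (@UC_lipschitz _ (c / r)) => x y.
rewrite /bump -mulrBr normrM ger0_norm// -mulrA ler_wpM2l//.
have maxB (s t : R) : `|Num.max 0 s - Num.max 0 t| <= `|s - t|.
  have := ler_norm (s - t); have := ler_norm (t - s); rewrite distrC ler_norml.
  by case: (leP 0 s); case: (leP 0 t) => *; apply/andP; split; lra.
rewrite (le_trans (maxB _ _))//.
have -> : 1 - mdist a x / r - (1 - mdist a y / r) =
  r^-1 * (mdist a y - mdist a x) by ring.
rewrite normrM gtr0_norm ?invr_gt0// ler_wpM2l ?invr_ge0 ?(ltW r0)//.
have := metric_triangle a x y; have := metric_triangle a y x.
by rewrite (metric_sym y x) ler_norml => *; apply/andP; split; lra.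
Qed.

End UniformContinuity.

Section RingCriterion.
Context {R : realType} {X : metricType R}.

Lemma UC_is_ring_of_isolated :
  (forall A : set X, ~ bourbaki_bounded A ->
    exists F : set X, [/\ F `<=` A, infinite_set F & uniformly_isolated F]) ->
  UC_is_ring X.
Proof.
move=> iso; apply/UC_is_ringP => f g Uf Ug; apply/UC_P => e e0.
apply: contrapT => fgN.
have : forall n : nat, exists z : X * X,
    mdist z.1 z.2 < n.+1%:R^-1 /\ e <= `|f z.1 * g z.1 - f z.2 * g z.2|.
  move=> n; apply: contrapT => zN; apply: fgN; exists n.+1%:R^-1 => // x y xyd.
  by rewrite ltNge; apply/negP => exy; apply: zN; exists (x, y).
move=> /choice[z zP].
have [BA|/iso[F [FA Finf /uniformly_isolatedP[d d0 Fd]]]] :=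
    pselect (bourbaki_bounded (range (fst \o z))).
  have [d d0 fgd] := UC_mul_bounded Uf Ug (BA _ Uf) (BA _ Ug) e0.
  have [N Nd] := invnS_lt d0; have [zN] := zP N.
  rewrite leNgt => /negP; apply; apply: fgd; first by exists N.
  by rewrite (lt_trans zN)// Nd.
have [N Nd] := invnS_lt d0; apply: Finf.
apply: (@sub_finite_set _ _ ((fst \o z) @` `I_N)); last exact: finite_image.
move=> a Fa; have [n _ zna] := FA _ Fa; exists n => //=.
rewrite ltnNge; apply/negP => /Nd nd; have [znd ezn] := zP n.
have zn : (z n).2 != a.
  apply: contraTneq ezn => zn2; rewrite -ltNge.
  by rewrite [(z n).1]zna zn2 subrr normr0.
have := Fd _ _ Fa zn; rewrite leNgt -zna /= => /negP; apply.
exact: lt_trans nd.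
Qed.

Lemma unbounded_not_isolated (f : X -> R) (A : set X) :
    ~ [bounded f x | x in A] ->
    ~ (exists F : set X,
        [/\ F `<=` A, infinite_set F & uniformly_isolated F]) ->
  forall t e : R, 0 < e -> exists x y : X,
    [/\ t < `|f x|, y != x & mdist x y < e].
Proof.
move=> fA noF t e e0; apply: contrapT => xyN; apply: noF.
exists [set a | A a /\ t < `|f a|]; split=> [a []//| |]; last first.
  apply/uniformly_isolatedP; exists e => // a x [_ ta] xa; rewrite leNgt.
  by apply/negP => axe; apply: xyN; exists a, x.
move=> /(finite_set_bounded_on f)[M fM]; apply: fA; apply/bounded_on_setP.
exists (Num.max t M) => x Ax; rewrite le_max.
by have [//|tfx] := leP `|f x| t; rewrite fM.
Qed.

Lemma isolated_of_UC_is_ring (A : set X) :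
  UC_is_ring X -> ~ bourbaki_bounded A ->
  exists F : set X, [/\ F `<=` A, infinite_set F & uniformly_isolated F].
Proof.
move=> /UC_is_ringP UM /existsNP[f /not_implyP[Uf fA]].
apply: contrapT => noF.
have UF := UC_norm Uf.
have [d d0 fd] := (UC_P _).1 UF _ (divr_gt0 ltr01 (ltr0Sn R 1)).
have : forall q : nat * R, exists z : X * X, [/\ q.2 < `|f z.1|, z.2 != z.1 &
    mdist z.1 z.2 < Num.min d q.1.+1%:R^-1].
  move=> [n t]; have e0 : 0 < Num.min d n.+1%:R^-1.
    by rewrite lt_min d0 invr_gt0/=.
  by have [x [y]] := unbounded_not_isolated fA noF t e0; exists (x, y).
move=> /choice[G GP].
pose z := fix z n := if n is m.+1 then G (n, `|f (z m).1| + 1) else G (0%N, 1).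
pose x n := (z n).1; pose y n := (z n).2; pose r n := mdist (x n) (y n).
have zG n : exists t, z n = G (n, t) by case: n => [|n]; eexists.
have yx n : y n != x n by rewrite /y /x; have [t ->] := zG n; case: (GP (n, t)).
have rd n : r n < Num.min d n.+1%:R^-1.
  by rewrite /r /y /x; have [t ->] := zG n; case: (GP (n, t)).
have r0 n : 0 < r n by rewrite mdist_gt0 eq_sym.
have fS n : `|f (x n)| + 1 < `|f (x n.+1)|.
  by have [] := GP (n.+1, `|f (x n)| + 1).
have f_gt n : n.+1%:R < `|f (x n)|.
  elim: n => [|n IHn]; first by have [] := GP (0%N, 1).
  by rewrite -natr1 (lt_trans _ (fS n))// ltrD2r.
have sep m n : (m < n)%N -> `|f (x m)| + 1 < `|f (x n)|.
  elim: n => // n IHn; rewrite ltnS leq_eqVlt => /orP[/eqP->//|/IHn/lt_trans].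
  by apply; apply: le_lt_trans (fS n); rewrite lerDl.
pose B n := bump (x n) (r n) (`|f (x n)|^-1).
have fpos n : 0 < `|f (x n)| by rewrite (lt_trans _ (f_gt n)).
have B_ge0_le n u : 0 <= B n u <= n.+1%:R^-1.
  have /andP[-> /le_trans->//] : 0 <= B n u <= `|f (x n)|^-1.
    by apply: bump_ge0_le => //; rewrite invr_ge0.
  by rewrite lef_pV2 ?posrE// ltW.
have UB n : UC X (B n) by apply: UC_bump => //; rewrite invr_ge0.
pose h u := sup (range (B^~ u)).
have Uh : UC X h := UC_sup UB B_ge0_le (@cvg_harmonic R).
have hx n : `|f (x n)|^-1 <= h (x n).
  apply: ub_le_sup; last by exists n => //; exact: bump_center.
  exists 1 => _ [m _ <-]; have /andP[_ /le_trans->//] := B_ge0_le m (x n).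
  by rewrite invf_le1// ler1n.
have By m n : B m (y n) = 0.
  apply: bump_out => //; have [->//|mn] := eqVneq m n.
  rewrite leNgt; apply/negP => xyr.
  have /fd fmn : mdist (x m) (y n) < d.
    by rewrite (lt_trans xyr)//; have := rd m; rewrite lt_min => /andP[].
  have /fd fnn : mdist (x n) (y n) < d.
    by have := rd n; rewrite lt_min => /andP[].
  move: fmn fnn; rewrite !ltr_norml => /andP[? ?] /andP[? ?].
  by have [/sep|/sep|/eqP] := ltngtP m n; [lra|lra|rewrite (negPf mn)].
have hy n : h (y n) = 0.
  rewrite /h (_ : range (B^~ (y n)) = [set 0]) ?sup1//.
  by apply/seteqP; split=> [_ [m _ <-]|_ ->]; [exact: By|exists 0%N].
have /UC_P/(_ _ ltr01)[s s0 fhs] := UM _ _ UF Uh.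
have [N Ns] := invnS_lt s0.
have /fhs : mdist (x N) (y N) < s.
  by rewrite (lt_trans _ (Ns N _))//; have := rd N; rewrite lt_min => /andP[].
rewrite hy mulr0 subr0 ltNge => /negP; apply.
rewrite (le_trans _ (ler_norm _))// -(mulfV (lt0r_neq0 (fpos N))).
by rewrite ler_wpM2l.
Qed.

End RingCriterion.

Theorem theorem2p5 (R : realType) (X : metricType R) :
  UC_is_ring X <->
  forall A : set X, ~ bourbaki_bounded A ->
    exists F : set X, [/\ F `<=` A, infinite_set F & uniformly_isolated F].
Proof.
split=> [ringX A|]; last exact: UC_is_ring_of_isolated.
exact: isolated_of_UC_is_ring.
Qed.
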